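(* Let $\rho>0$ and $\lambda\in\mathbb R^m$, and for $j=1,\dots,m_{\mathrm{sos}}$ let $A_{\mathrm{sos}}^{(j)}\in\mathbb R^{m\times h_j(h_j+1)/2}$, $w_{\mathrm{sos}}^{(j)}\in\mathbb R^{h_j(h_j+1)/2}$ and $$\mathcal L_{\mathrm{sos}}(\xi_{\mathrm{sos}}^{(j)},\lambda)=\tfrac\rho2\|\xi_{\mathrm{sos}}^{(j)}\|_2^2+{w_{\mathrm{sos}}^{(j)}}^\top\xi_{\mathrm{sos}}^{(j)}-\lambda^\top A_{\mathrm{sos}}^{(j)}\xi_{\mathrm{sos}}^{(j)} .$$ Then the minimizer $\mathcal S_{\xi_{\mathrm{sos}}^{(j)}}(\lambda)=\operatorname{arg\,min}_{\xi_{\mathrm{sos}}^{(j)}\in\mathbb S_+^{h_j}}\mathcal L_{\mathrm{sos}}(\xi_{\mathrm{sos}}^{(j)},\lambda)$ is given by $$\mathcal S_{\xi_{\mathrm{sos}}^{(j)}}(\lambda)=\mathcal P_{\mathbb S_+^{h_j}}\Bigl(\tfrac1\rho\bigl({A_{\mathrm{sos}}^{(j)}}^\top\lambda-w_{\mathrm{sos}}^{(j)}\bigr)\Bigr)\qquad\text{for all } j=1,\dots,m_{\mathrm{sos}}.$$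
   Context: $m,m_{\mathrm{sos}},h_j\ge1$ are integers. For a symmetric $h\times h$ matrix $X$, $\operatorname{svec}(X)\in\mathbb R^{h(h+1)/2}$ stacks its upper triangular entries with off-diagonal entries multiplied by $\sqrt2$ (so $\|X\|_{\mathrm F}=\|\operatorname{svec}(X)\|_2$), and $\operatorname{smat}$ is its inverse. A vector $\zeta\in\mathbb R^{h(h+1)/2}$ is identified with $\operatorname{smat}(\zeta)$: ''$\zeta\in\mathbb S_+^h$'' means $\operatorname{smat}(\zeta)$ is positive semidefinite, and $\mathcal P_{\mathbb S_+^h}(\zeta)$ denotes the Euclidean projection of $\zeta$ onto this cone, i.e. $\operatorname{svec}$ of the Frobenius projection of $\operatorname{smat}(\zeta)$ onto the positive semidefinite matrices. *)

(* Defs.v *)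
From HB Require Import structures.
From mathcomp Require Import all_boot all_order all_algebra.
From mathcomp Require Import boolp classical_sets reals.

Set Implicit Arguments.
Unset Strict Implicit.
Unset Printing Implicit Defensive.

Import Order.TTheory GRing.Theory Num.Theory.
Local Open Scope ring_scope.

(* All vectors are column vectors. [norm2] is needed because the library norm
   [`|x|] on matrices is the max norm. *)
Definition norm2 {R : realType} {n : nat} (x : 'cV[R]_n) : R :=
  Num.sqrt (\sum_i x i 0 ^+ 2).

Definition fnorm {R : realType} {m n : nat} (X : 'M[R]_(m, n)) : R :=
  Num.sqrt (\sum_i \sum_j X i j ^+ 2).

Definition argmin {R : realType} {T : Type} (C : set T) (f : T -> R) : set T :=
  [set x | C x /\ forall y, C y -> f x <= f y].

(* A nearest point of [C] to [z]; the value is arbitrary where no nearest point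
   exists or where there are several. *)
Definition euclid_proj {R : realType} {n : nat} (C : set 'cV[R]_n)
    (z : 'cV[R]_n) : 'cV[R]_n :=
  xget 0 (argmin C (fun x => norm2 (z - x))).

Definition upper (h : nat) : {set 'I_h * 'I_h} :=
  [set p : 'I_h * 'I_h | (p.1 <= p.2)%N].

Lemma card_upper (h : nat) : #|upper h| = ((h * h.+1)./2)%N.
Proof.
rewrite -sum1_card.
under eq_bigl => p do rewrite inE.
rewrite -(pair_big_dep xpredT (fun i j : 'I_h => (i <= j)%N) (fun _ _ => 1%N)).
rewrite (exchange_big_dep xpredT) //=.
have E (j : 'I_h) : (\sum_(i < h | i <= j) 1)%N = j.+1.
  rewrite (_ : j.+1 = (\sum_(i < j.+1) 1)%N); last by rewrite sum1_card card_ord.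
  exact/esym/(big_ord_widen_cond h xpredT (fun _ => 1%N) (ltn_ord j)).
under eq_bigr do rewrite E.
have -> : (h * h.+1)./2 = 'C(h.+1, 2) by rewrite bin2 mulnC.
by rewrite -bin2_sum big_mkord big_ord_recl add0n.
Qed.

(* The upper triangle is stacked row by row (the enumeration of a product type
   is lexicographic). *)
Definition upos {h : nat} (k : 'I_((h * h.+1)./2)) : 'I_h * 'I_h :=
  enum_val (cast_ord (esym (card_upper h)) k).

Definition usort {h : nat} (i j : 'I_h) : 'I_h * 'I_h :=
  if (i <= j)%N then (i, j) else (j, i).

Lemma usort_upper {h : nat} (i j : 'I_h) : usort i j \in upper h.
Proof. by rewrite /usort inE; case: (leqP i j) => //= /ltnW. Qed.

(* The position in [svec X] of the entry (i, j), equivalently (j, i). *)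
Definition uidx {h : nat} (i j : 'I_h) : 'I_((h * h.+1)./2) :=
  cast_ord (card_upper h) (enum_rank_in (usort_upper i j) (usort i j)).

Definition svec {R : realType} {h : nat} (X : 'M[R]_h) :
    'cV[R]_((h * h.+1)./2) :=
  \col_k (let: (i, j) := upos k in
          if i == j then X i j else Num.sqrt 2 * X i j).

Definition smat {R : realType} {h : nat} (z : 'cV[R]_((h * h.+1)./2)) :
    'M[R]_h :=
  \matrix_(i, j) (if i == j then z (uidx i j) 0
                  else z (uidx i j) 0 / Num.sqrt 2).

Definition psd {R : realType} {h : nat} : set 'M[R]_h :=
  [set X | X^T = X /\ forall v : 'cV[R]_h, 0 <= (v^T *m X *m v) 0 0].

Definition psd_cone {R : realType} {h : nat} : set 'cV[R]_((h * h.+1)./2) :=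
  [set z | psd (smat z)].

Definition Lsos {R : realType} {m n : nat} (rho : R) (A : 'M[R]_(m, n))
    (w xi : 'cV[R]_n) (lambda : 'cV[R]_m) : R :=
  rho / 2 * norm2 xi ^+ 2 + (w^T *m xi) 0 0 - (lambda^T *m A *m xi) 0 0.

Section SvecTheory.
Variables (R : realType) (h : nat).
Implicit Types (X : 'M[R]_h) (z : 'cV[R]_((h * h.+1)./2)).

Lemma upos_upper (k : 'I_((h * h.+1)./2)) : ((upos k).1 <= (upos k).2)%N.
Proof. by have := enum_valP (cast_ord (esym (card_upper h)) k); rewrite inE. Qed.

Lemma upos_idx (i j : 'I_h) : upos (uidx i j) = usort i j.
Proof. by rewrite /upos /uidx cast_ordK enum_rankK_in ?usort_upper. Qed.

Lemma upos_inj : injective (@upos h).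
Proof. by move=> k l /enum_val_inj /cast_ord_inj. Qed.

Lemma uidx_pos (k : 'I_((h * h.+1)./2)) : uidx (upos k).1 (upos k).2 = k.
Proof.
apply: upos_inj; rewrite upos_idx /usort upos_upper.
by case: (upos k).
Qed.

Lemma uidxC (i j : 'I_h) : uidx i j = uidx j i.
Proof.
apply: upos_inj; rewrite !upos_idx /usort.
by case: (ltngtP i j) => // /val_inj ->.
Qed.

Let sqrt2_neq0 : Num.sqrt 2 != 0 :> R.
Proof. by rewrite sqrtr_eq0 -ltNge ltr0n. Qed.

Lemma smat_sym z : (smat z)^T = smat z.
Proof. by apply/matrixP => i j; rewrite !mxE eq_sym uidxC. Qed.

Lemma smatK : cancel (@smat R h) (@svec R h).
Proof.
move=> z; apply/colP => k; rewrite !mxE.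
have := uidx_pos k; case: (upos k) => i j /= E; rewrite !mxE E.
by case: eqP => // _; rewrite mulrC divfK.
Qed.

Lemma svecK X : X^T = X -> smat (svec X) = X.
Proof.
move=> symX; apply/matrixP => i j; rewrite !mxE upos_idx /usort.
have XC : X j i = X i j by rewrite -[in LHS]symX mxE.
case: (leqP i j) => _; first by case: eqP => // _; rewrite mulrC mulKf.
by rewrite eq_sym XC; case: eqP => // _; rewrite mulrC mulKf.
Qed.

Lemma norm2_svec X : X^T = X -> norm2 (svec X) = fnorm X.
Proof.
move=> symX; congr Num.sqrt.
have XC i j : X j i = X i j by rewrite -[in LHS]symX mxE.
pose F (p : 'I_h * 'I_h) : R := X p.1 p.2 ^+ 2.
pose G (p : 'I_h * 'I_h) : R := if p.1 == p.2 then F p else F p *+ 2.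
transitivity (\sum_(p in upper h) G p).
  rewrite [RHS]big_enum_val (reindex (cast_ord (card_upper h))) /=; last first.
    by exists (cast_ord (esym (card_upper h))) => k _;
      rewrite ?cast_ordK ?cast_ordKV.
  apply: eq_bigr => k _; rewrite mxE /upos cast_ordK /G /F.
  case: (enum_val k) => i j /=; case: eqP => // _.
  by rewrite exprMn sqr_sqrtr ?ler0n // mulr_natl.
rewrite pair_big /= -/(\sum_p F p).
rewrite [RHS](bigID (fun p : 'I_h * 'I_h => (p.1 <= p.2)%N)) /=.
have -> : \sum_(p : 'I_h * 'I_h | ~~ (p.1 <= p.2)%N) F p =
    \sum_(p : 'I_h * 'I_h | (p.1 <= p.2)%N && (p.1 != p.2)) F p.
  rewrite (reindex_inj (h := fun p : 'I_h * 'I_h => (p.2, p.1))) /=;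
    last by move=> [? ?] [? ?] [-> ->].
  apply: eq_big => [[i j]|[i j] _] /=; last by rewrite /F /= XC.
  by rewrite -ltnNge ltn_neqAle andbC.
rewrite [X in _ = _ + X]big_mkcondr -big_split /=.
apply: eq_big => [p|p _]; first by rewrite inE.
by rewrite /G /F; case: eqP => /= _; rewrite ?addr0 ?mulr2n.
Qed.

(* The Euclidean nearest points of the cone are the images under [svec] of the
   Frobenius nearest positive semidefinite matrices. *)
Lemma argmin_psd_cone z :
  argmin psd_cone (fun x => norm2 (z - x)) =
  (@svec R h @` argmin psd (fun X => fnorm (smat z - X)))%classic.
Proof.
have svecB X : svec (smat z - X) = z - svec X.
  rewrite -[in RHS](smatK z); apply/colP => k; rewrite !mxE.
  by case: (upos k) => i j; rewrite !mxE; case: eqP => // _; rewrite mulrBr.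
have dist X : X^T = X -> norm2 (z - svec X) = fnorm (smat z - X).
  by move=> symX; rewrite -svecB norm2_svec // linearB /= smat_sym symX.
apply/seteqP; split => [x [Cx minx]|_ [X [pX minX] <-]].
  exists (smat x); last exact: smatK.
  split=> // Y [symY pY]; rewrite -!dist ?smat_sym // smatK.
  by apply: minx; rewrite /psd_cone /= svecK.
have symX := pX.1; split=> [|y Cy]; first by rewrite /psd_cone /= svecK.
by rewrite dist // -(smatK y) dist ?smat_sym //; apply: minX.
Qed.

End SvecTheory.

(* Main.v *)
Require Import Defs.
From HB Require Import structures.
From mathcomp Require Import all_boot all_order all_algebra.
From mathcomp Require Import boolp classical_sets reals.
From mathcomp Require Import ring lra.
From mathcomp Require Import topology normedtype realfun derive.

Set Implicit Arguments.
Unset Strict Implicit.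
Unset Printing Implicit Defensive.

Import Order.TTheory GRing.Theory Num.Theory.
Import numFieldNormedType.Exports.
Local Open Scope ring_scope.
Local Open Scope classical_set_scope.

(** Write [z = rho^-1 *: (A^T *m lambda - w)]. Since [rho > 0], completing the
    square turns the objective into
    [rho / 2 * norm2 (z - xi) ^+ 2] minus a constant ([Lsos_sqr]), an increasing
    function of the distance from [xi] to [z]. Hence, over any set, the
    minimizers of the objective are exactly the points nearest to [z].

    What remains is that the projection is well defined: the set of points of
    the cone nearest to [z] is a singleton, so that [euclid_proj], a choice of
    an element of that set, is its only element ([argmin_euclid_proj]). This
    holds for every nonempty closed convex set. A nearest point exists by
    compactness ([exists_nearest]) and is unique by strict convexity of the
    squared norm ([nearest_unique]). The positive semidefinite cone qualifies
    because it is the intersection, over all vectors [v], of the sets of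
    [xi] with [0 <= v^T *m smat xi *m v], each given by a continuous linear form
    in [xi] ([psd_coneE]); symmetry of [smat xi] is automatic. *)

(** * Minimizers and the Euclidean norm *)

Lemma eq_argmin (R : realType) (T : Type) (C : set T) (f g : T -> R) :
  (forall x y, (f x <= f y) = (g x <= g y)) -> argmin C f = argmin C g.
Proof.
by move=> fg; apply/seteqP; split=> x [Cx minx]; split=> // y /minx;
  rewrite fg.
Qed.

Lemma sqr_norm2 (R : realType) (n : nat) (x : 'cV[R]_n) :
  norm2 x ^+ 2 = \sum_i x i 0 ^+ 2.
Proof. by rewrite sqr_sqrtr // sumr_ge0 // => i _; exact: sqr_ge0. Qed.

Lemma norm2_ge0 (R : realType) (n : nat) (x : 'cV[R]_n) : 0 <= norm2 x.
Proof. exact: sqrtr_ge0. Qed.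

Lemma norm2_eq0 (R : realType) (n : nat) (x : 'cV[R]_n) :
  norm2 x = 0 -> x = 0.
Proof.
move=> x0; apply/colP => i; rewrite mxE; apply/eqP.
rewrite -sqrf_eq0; move: (sqr_norm2 x); rewrite x0 expr0n /= => /esym/eqP.
by rewrite psumr_eq0 => [/allP/(_ i (mem_index_enum i))|k _]; rewrite ?sqr_ge0.
Qed.

Lemma coord_le_norm2 (R : realType) (n : nat) (x : 'cV[R]_n) (i : 'I_n) :
  `|x i 0| <= norm2 x.
Proof.
rewrite -(@ler_pXn2r _ 2) ?nnegrE ?norm2_ge0 // real_normK ?num_real //.
rewrite sqr_norm2 (bigD1 i) //= lerDl sumr_ge0 // => k _; exact: sqr_ge0.
Qed.

(** Nearest points are unique in a midpoint-convex set because of this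
    identity: two distinct points at the same distance from [z] have a
    midpoint strictly closer to [z]. *)
Lemma midpoint_norm2 (R : realType) (n : nat) (z x y : 'cV[R]_n) :
  norm2 (z - 2^-1 *: (x + y)) ^+ 2 =
  (norm2 (z - x) ^+ 2 + norm2 (z - y) ^+ 2) / 2 - norm2 (x - y) ^+ 2 / 4.
Proof.
rewrite !sqr_norm2 -big_split !mulr_suml -sumrB /=.
by apply: eq_bigr => i _; rewrite !mxE; field.
Qed.

Lemma norm2B_sqr (R : realType) (n : nat) (z x : 'cV[R]_n) :
  norm2 (z - x) ^+ 2 =
  norm2 x ^+ 2 - 2 * (z^T *m x) 0 0 + norm2 z ^+ 2.
Proof.
rewrite !sqr_norm2 mxE mulr_sumr -sumrB -big_split /=.
by apply: eq_bigr => i _; rewrite !mxE; ring.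
Qed.

(** * Nearest points of closed convex sets *)

Lemma sum_continuous (R : realType) (T : topologicalType) (I : Type)
    (r : seq I) (f : I -> T -> R) :
  (forall i, continuous (f i)) -> continuous (fun x => \sum_(i <- r) f i x).
Proof.
by move=> fc; apply: continuous_big => //; exact: add_continuous.
Qed.

Lemma trmx_continuous (R : realType) (m n : nat) :
  continuous (fun M : 'M[R]_(m, n) => M^T).
Proof.
move=> M s /(nbhs_ballP (M^T)) [e e0 es].
apply/nbhs_ballP; exists e => //= N [_ MN].
by apply: es; split=> // i j; rewrite !mxE; exact: MN.
Qed.

Lemma norm2B_continuous (R : realType) (n : nat) (z : 'cV[R]_n) :
  continuous (fun x : 'cV[R]_n => norm2 (z - x)).
Proof.
move=> x; apply: (@continuous_comp _ _ _
  (fun x : 'cV[R]_n => \sum_i (z - x) i 0 ^+ 2) Num.sqrt);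
  last exact: sqrt_continuous.
apply: sum_continuous => i {}x.
apply: (@continuous_comp _ _ _ (fun x : 'cV[R]_n => (z - x) i 0)
  (fun t : R => t ^+ 2)); last exact: exprn_continuous.
rewrite (_ : (fun y => _) = (fun y : 'cV[R]_n => z i 0 - y i 0)); last first.
  by apply/funext => y; rewrite !mxE.
apply: continuousB; [exact: cst_continuous|exact: coord_continuous].
Qed.

(** Only the part of [C] no farther from [z] than a given point of [C]
    matters, and that part is compact. Transposition carries it to row vectors,
    for which products of segments are compact. *)
Lemma exists_nearest (R : realType) (n : nat) (C : set 'cV[R]_n)
    (z : 'cV[R]_n) :
  closed C -> C !=set0 -> argmin C (fun x => norm2 (z - x)) !=set0.
Proof.
move=> Ccl [c Cc]; set r := norm2 (z - c).
pose d (u : 'rV[R]_n) := norm2 (z - u^T).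
have dc : continuous d.
  move=> u; apply: (@continuous_comp _ _ _ trmx (fun x => norm2 (z - x))).
    exact: trmx_continuous.
  exact: norm2B_continuous.
pose K := trmx @^-1` C `&` d @^-1` [set t | t <= r].
have Kcl : closed K.
  apply: closedI.
    by apply: preimage_closed Ccl => u _; exact: trmx_continuous.
  by apply: preimage_closed (@closed_le _ _) => u _; exact: dc.
have Kco : compact K.
  apply: (@subclosed_compact _ _
    [set v : 'rV[R]_n | forall i, `[z i 0 - r, z i 0 + r] (v ord0 i)]) => //.
    apply: (@rV_compact _ _ (fun i => `[z i 0 - r, z i 0 + r])) => i.
    exact: segment_compact.
  move=> u [_ /= du] i; rewrite /= in_itv /= -ler_distlC.
  apply: le_trans du; have := coord_le_norm2 (z - u^T) i.
  by rewrite !mxE.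
have K0 : K !=set0 by exists c^T; rewrite /K /d /= trmxK.
have [u /set_mem [Cu du] minu] :=
  EVT_min_rV K0 Kco (continuous_subspaceT dc).
exists u^T; split=> // y Cy.
have [yr|/ltW ry] := leP (norm2 (z - y)) r; last exact: le_trans ry.
have Ky : y^T \in K by apply/mem_set; rewrite /K /d /= trmxK.
by have := minu _ Ky; rewrite /d trmxK.
Qed.

Lemma nearest_unique (R : realType) (n : nat) (C : set 'cV[R]_n)
    (z x y : 'cV[R]_n) :
  (forall u v, C u -> C v -> C (2^-1 *: (u + v))) ->
  argmin C (fun x => norm2 (z - x)) x -> argmin C (fun x => norm2 (z - x)) y ->
  x = y.
Proof.
move=> Cmid [Cx minx] [Cy miny].
have exy : norm2 (z - x) = norm2 (z - y).
  by apply/eqP; rewrite eq_le minx ?miny.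
have le_mid : norm2 (z - x) ^+ 2 <= norm2 (z - 2^-1 *: (x + y)) ^+ 2.
  by rewrite ler_pXn2r ?nnegrE ?norm2_ge0 //; apply/minx/Cmid.
apply/subr0_eq/norm2_eq0/eqP; rewrite -sqrf_eq0 eq_le sqr_ge0 andbT.
by move: le_mid; rewrite midpoint_norm2 -exy; lra.
Qed.

(** [euclid_proj] picks an arbitrary element of the set of nearest points; for
    such a set [C] there is exactly one to pick. *)
Lemma argmin_euclid_proj (R : realType) (n : nat) (C : set 'cV[R]_n)
    (z : 'cV[R]_n) :
  closed C -> C !=set0 -> (forall u v, C u -> C v -> C (2^-1 *: (u + v))) ->
  argmin C (fun x => norm2 (z - x)) = [set euclid_proj C z].
Proof.
move=> Ccl C0 Cmid; have [x minx] := exists_nearest z Ccl C0.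
have minp : argmin C (fun x => norm2 (z - x)) (euclid_proj C z).
  by apply: (@xgetPex _ 0); exists x.
apply/seteqP; split=> [y miny|_ ->] //=.
exact: nearest_unique miny minp.
Qed.

(** * The cone of positive semidefinite matrices *)

Lemma psd_coneE (R : realType) (h : nat) :
  @psd_cone R h =
  \bigcap_(v in [set: 'cV[R]_h])
    [set z | 0 <= (v^T *m smat z *m v) 0 0].
Proof.
apply/seteqP; split=> [z [_ pz] v _|z pz]; first exact: pz.
by split=> [|v]; [exact: smat_sym|exact: pz].
Qed.

(** The quadratic form at a fixed [v] is a linear form in the coordinates of
    [z], with coefficients [a i j] absorbing the scaling of the off-diagonal
    entries by [smat]. *)
Lemma quad_smat_continuous (R : realType) (h : nat) (v : 'cV[R]_h) :
  continuous (fun z : 'cV[R]_((h * h.+1)./2) => (v^T *m smat z *m v) 0 0 : R).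
Proof.
pose a i j := v i 0 * v j 0 / (if i == j then 1 else Num.sqrt 2).
rewrite (_ : (fun z => _) = (fun z : 'cV[R]_((h * h.+1)./2) =>
    \sum_j \sum_i a i j * z (uidx i j) 0)).
  apply: sum_continuous => j; apply: sum_continuous => i z.
  apply: (@continuousM R _ (fun=> a i j)
    (fun z : 'cV[R]_((h * h.+1)./2) => z (uidx i j) 0)).
    exact: cst_continuous.
  exact: coord_continuous.
apply/funext => z; rewrite mxE; apply: eq_bigr => j _; rewrite mxE mulr_suml.
apply: eq_bigr => i _; rewrite !mxE /a.
by case: eqP => _; rewrite ?divr1; ring.
Qed.

Lemma psd_cone_closed (R : realType) (h : nat) : closed (@psd_cone R h).
Proof.
rewrite psd_coneE; apply: closed_bigI => v _.
apply: (@preimage_closed _ _ _ [set t : R | 0 <= t]); last exact: closed_ge.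
by move=> z _; exact: quad_smat_continuous.
Qed.

Lemma smatZD (R : realType) (h : nat) (a : R)
    (x y : 'cV[R]_((h * h.+1)./2)) :
  smat (a *: (x + y)) = a *: (smat x + smat y).
Proof.
by apply/matrixP => i j; rewrite !mxE; case: eqP => // _; ring.
Qed.

Lemma psd_cone_mid (R : realType) (h : nat) (x y : 'cV[R]_((h * h.+1)./2)) :
  psd_cone x -> psd_cone y -> psd_cone (2^-1 *: (x + y)).
Proof.
rewrite psd_coneE => px py v _ /=.
rewrite smatZD -scalemxAr -scalemxAl mulmxDr mulmxDl !mxE.
apply: mulr_ge0; first by rewrite invr_ge0 ler0n.
by have := addr_ge0 (px v I) (py v I); rewrite /= !mxE.
Qed.

Lemma psd_cone0 (R : realType) (h : nat) : @psd_cone R h 0.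
Proof.
rewrite psd_coneE => v _ /=.
have -> : smat 0 = 0 :> 'M[R]_h.
  by apply/matrixP => i j; rewrite !mxE mul0r; case: ifP.
by rewrite mulmx0 mul0mx mxE.
Qed.

(** * Completing the square *)

(** Only the first term on the right depends on [xi], and for [rho > 0] it
    increases with the distance from [xi] to [z]: minimizing the objective is
    then projecting [z]. *)
Lemma Lsos_sqr (R : realType) (m n : nat) (rho : R) (A : 'M[R]_(m, n))
    (w xi : 'cV[R]_n) (lambda : 'cV[R]_m) :
  rho != 0 ->
  let z := rho^-1 *: (A^T *m lambda - w) in
  Lsos rho A w xi lambda =
  rho / 2 * norm2 (z - xi) ^+ 2 - rho / 2 * norm2 z ^+ 2.
Proof.
move=> rho0 z; rewrite norm2B_sqr /Lsos.
have -> : (z^T *m xi) 0 0 =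
    rho^-1 * ((lambda^T *m A *m xi) 0 0 - (w^T *m xi) 0 0).
  rewrite linearZ /= -scalemxAl linearB /= trmx_mul trmxK mulmxBl.
  by rewrite [LHS]mxE [X in _ * X]mxE [X in _ + X]mxE.
by field.
Qed.

Theorem lemma3p2 (R : realType) (m msos : nat) (h : 'I_msos -> nat)
    (hm : (1 <= m)%N) (hmsos : (1 <= msos)%N) (hh : forall j, (1 <= h j)%N)
    (rho : R) (hrho : 0 < rho) (lambda : 'cV[R]_m)
    (A : forall j : 'I_msos, 'M[R]_(m, (h j * (h j).+1)./2))
    (w : forall j : 'I_msos, 'cV[R]_((h j * (h j).+1)./2)) :
  forall j : 'I_msos,
    argmin psd_cone (fun xi => Lsos rho (A j) (w j) xi lambda)
    = [set euclid_proj psd_cone (rho^-1 *: ((A j)^T *m lambda - w j))].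
Proof.
move=> j; set z := rho^-1 *: _.
rewrite -argmin_euclid_proj; first last.
- exact: psd_cone_mid.
- by exists 0; exact: psd_cone0.
- exact: psd_cone_closed.
(* Both sides are now minimizers over the same cone; the two objectives order
   its points in the same way. *)
apply: eq_argmin => x y; rewrite !Lsos_sqr ?gt_eqF // -/z lerD2r.
by rewrite ler_pM2l ?divr_gt0 // ler_pXn2r ?nnegrE ?norm2_ge0.
Qed.
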